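(* Let $\Gamma$ be an inverse semigroup. The groupoid $G_u(\Gamma)$ is a topological groupoid, with basis of the topology given by the family of sets $U_{x;x_1,\ldots,x_n}$ for arbitrary $x_1,\ldots,x_n\prec x$ in $\Gamma$. These sets are compact $G_u(\Gamma)$-sets on which $r$ and $s$ are homeomorphisms (onto their images). The map $U:\Gamma\to S(G_u(\Gamma))$, $x\mapsto U_x$, is an injective homomorphism of inverse semigroups.
   Context: In an inverse semigroup, $x\prec y$ means $xy^{-1}=xx^{-1}$ (natural partial order). A subset $A\subset\Gamma$ is directed if it is nonempty and any two elements of $A$ have a common $\prec$-lower bound in $A$. For directed sets write $A\prec B$ if for every $b\in B$ there is $a\in A$ with $a\prec b$, and $A\sim B$ if $A\prec B$ and $B\prec A$. $\mathcal{O}(\Gamma)$ is the set of $\sim$-classes $[A]$ of directed sets; with $[A][B]=[AB]$ and $[A]^{-1}=[A^{-1}]$ (elementwise products and inverses) it is an inverse semigroup whose natural order is $[A]\prec[B]\iff A\prec B$. For $x\in\Gamma$ write $x$ also for $[\{x\}]\in\mathcal{O}(\Gamma)$. $G_u(\Gamma)$ is the groupoid with underlying set $\mathcal{O}(\Gamma)$, the inversion of $\mathcal{O}(\Gamma)$, and multiplication $X*Y=XY$ defined if and only if $X^{-1}X=YY^{-1}$. The range and source maps are $r(X)=XX^{-1}$, $s(X)=X^{-1}X$. For $x\in\Gamma$, $U_x=\{X\in G_u(\Gamma):X\prec x\}$; for $x_1,\ldots,x_n\prec x$ ($n\ge 0$), $U_{x;x_1,\ldots,x_n}=U_x\cap U_{x_1}^c\cap\cdots\cap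 U_{x_n}^c$, complements taken in $\mathcal{O}(\Gamma)$ (for $n=0$ this is $U_x$). The topology of $G_u(\Gamma)$ is the family of all unions of sets of this form; it need not be Hausdorff, and compact means that every open cover has a finite subcover. A $G$-set of a groupoid $G$ is a subset on which $r$ and $s$ are injective; $S(G)$ denotes the inverse semigroup of $G$-sets under $AB=\{a*b: a\in A,b\in B, a*b \text{ defined}\}$ and elementwise inversion. *)

(* Defs.v *)
From HB Require Import structures.
From mathcomp Require Import all_boot.
From mathcomp Require Import all_classical topology.

Set Implicit Arguments.
Unset Strict Implicit.
Unset Printing Implicit Defensive.

Local Open Scope classical_set_scope.

Declare Scope invsemigroup_scope.
Delimit Scope invsemigroup_scope with IS.
Local Open Scope invsemigroup_scope.

Reserved Notation "x \prec y" (at level 70, no associativity).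

Notation "x * y" := (monoid.mul x%IS y%IS) : invsemigroup_scope.


HB.mixin Record Semigroup_isInverse T of Semigroup T := {
  sinv : T -> T;
  smulVK : forall x : T, x * sinv x * x = x;
  smulKV : forall x : T, sinv x * x * sinv x = sinv x;
  sinv_unique : forall x y : T, x * y * x = x -> y * x * y = y -> y = sinv x
}.

#[short(type="invSemigroupType")]
HB.structure Definition InvSemigroup :=
  {T of Semigroup_isInverse T & Semigroup T}.

Bind Scope invsemigroup_scope with InvSemigroup.sort.
Notation "x ^-1" := (sinv x) : invsemigroup_scope.

Definition natle (T : invSemigroupType) (x y : T) : Prop :=
  x * y^-1 = x * x^-1.

Notation "x \prec y" := (natle x y) : invsemigroup_scope.

Lemma inv_unique_of_star (T : semigroupType) (i : T -> T) :
  involutive i -> (forall x y, i (x * y) = i y * i x) ->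
  (forall x, x * i x * x = x) ->
  (forall x y, (x * i x) * (y * i y) = (y * i y) * (x * i x)) ->
  forall x y, x * y * x = x -> y * x * y = y -> y = i x.
Proof.
move=> iK iM rg cm x y xyx yxy.
have idE (e : T) : e * e = e -> e = e * i e.
  move=> ee; have ii : i e * i e = i e by rewrite -iM ee.
  have rgi : i e * e * i e = i e by have := rg (i e); rewrite iK.
  suff eie : e = i e by rewrite -eie ee.
  transitivity ((e * i e) * (i e * e)).
    by rewrite monoid.mulgA -[e * i e * i e]monoid.mulgA ii rg.
  have -> : i e * e = i e * i (i e) by rewrite iK.
  rewrite cm iK monoid.mulgA -[i e * e * e]monoid.mulgA ee.
  exact: rgi.
have idC (e f : T) : e * e = e -> f * f = f -> e * f = f * e.
  by move=> ee ff; rewrite (idE e ee) (idE f ff); exact: cm.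
have rg' z : i z * z * i z = i z by have := rg (i z); rewrite iK.
have xyI : (x * y) * (x * y) = x * y by rewrite monoid.mulgA xyx.
have yxI : (y * x) * (y * x) = y * x by rewrite monoid.mulgA yxy.
have xiI : (x * i x) * (x * i x) = x * i x by rewrite monoid.mulgA rg.
have ixI : (i x * x) * (i x * x) = i x * x by rewrite monoid.mulgA rg'.
have -> : y = y * x * i x.
  rewrite -{1}yxy -{1}(rg x) -monoid.mulgA -[x * i x * x * y]monoid.mulgA.
  by rewrite (idC _ _ xiI xyI) !monoid.mulgA yxy.
transitivity ((i x * x) * (y * x) * i x).
  by rewrite (idC _ _ ixI yxI) -!monoid.mulgA (monoid.mulgA (i x)) rg'.
by rewrite -!monoid.mulgA (monoid.mulgA y) (monoid.mulgA x) (monoid.mulgA x y x) xyx monoid.mulgA rg'.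
Qed.

Section InvSemigroupTheory.
Context {T : invSemigroupType}.
Implicit Types x y z e f : T.

Let mulA := @monoid.mulgA T.

Lemma sinvK : involutive (@sinv T).
Proof.
by move=> x; apply/esym/sinv_unique; rewrite (smulVK, smulKV).
Qed.

Lemma idem_comm e f : e * e = e -> f * f = f -> e * f = f * e.
Proof.
have idem_mul (u v : T) : u * u = u -> v * v = v ->
    (u * v) * (u * v) = u * v.
  move=> uu vv; set w := u * v.
  have [w1 w2] := (smulVK w, smulKV w).
  have wE : w^-1 = v * w^-1 * u.
    apply/esym/sinv_unique.
      by rewrite -[RHS]w1 /w -!mulA (mulA u u) uu (mulA v v) vv.
    rewrite -{3}w2 /w -!mulA (mulA u u) uu (mulA v v) vv.
    by rewrite !mulA.
  have ww : w^-1 * w^-1 = w^-1.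
    rewrite {1 2}wE; transitivity (v * (w^-1 * w * w^-1) * u).
      by rewrite /w -!mulA.
    by rewrite w2 -wE.
  have wV : w^-1 = w^-1^-1 by apply: sinv_unique; rewrite !ww.
  by rewrite sinvK in wV; rewrite -wV.
move=> ee ff; have efI := idem_mul e f ee ff; have feI := idem_mul f e ff ee.
have fe : f * e = (e * f)^-1.
  apply: sinv_unique.
    by rewrite -[RHS]efI -!mulA (mulA f f) ff (mulA e e) ee.
  by rewrite -[RHS]feI -!mulA (mulA f f) ff (mulA e e) ee.
by rewrite fe; apply: sinv_unique; rewrite !efI.
Qed.

Lemma idemV e : e * e = e -> e^-1 = e.
Proof. by move=> ee; apply/esym/sinv_unique; rewrite !ee. Qed.

Lemma mulV_idem x : (x * x^-1) * (x * x^-1) = x * x^-1.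
Proof. by rewrite mulA smulVK. Qed.

Lemma Vmul_idem x : (x^-1 * x) * (x^-1 * x) = x^-1 * x.
Proof. by rewrite mulA smulKV. Qed.

Lemma sinvM x y : (x * y)^-1 = y^-1 * x^-1.
Proof.
apply/esym/sinv_unique.
  rewrite -!mulA (mulA y) (mulA (x^-1)) (mulA (y * _)).
  rewrite (idem_comm (mulV_idem y) (Vmul_idem x)).
  by rewrite !mulA smulVK -(mulA x) -(mulA x) smulVK.
rewrite -!mulA (mulA (x^-1)) (mulA y) (mulA (_ * x)).
rewrite (idem_comm (Vmul_idem x) (mulV_idem y)).
by rewrite !mulA smulKV -(mulA (y^-1)) -(mulA (y^-1)) smulKV.
Qed.

Lemma idemM e f :
  e * e = e -> f * f = f -> (e * f) * (e * f) = e * f.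
Proof.
move=> ee ff; rewrite -{1}(idem_comm ff ee) mulA -(mulA f e e) ee.
by rewrite (idem_comm ff ee) -mulA ff.
Qed.

Lemma natleP x y : x \prec y <-> exists2 e, e * e = e & x = e * y.
Proof.
split=> [xy|[e ee ->]].
  have xyV : y * x^-1 = x * x^-1.
    by have := congr1 sinv xy; rewrite !sinvM !sinvK.
  exists (x * x^-1); first exact: mulV_idem.
  have xE : x = y * (x^-1 * x) by rewrite mulA xyV smulVK.
  have VE : x^-1 = (x^-1 * x) * y^-1.
    by rewrite {1}xE sinvM (idemV (Vmul_idem x)).
  rewrite -xyV VE -!mulA (mulA (x^-1)).
  by rewrite (idem_comm (Vmul_idem x) (Vmul_idem y)) !mulA smulVK -mulA -xE.
rewrite /natle sinvM (idemV ee) -!mulA (mulA y).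
by rewrite (idem_comm (mulV_idem y) ee) (mulA e e) ee.
Qed.

Lemma natle_refl x : x \prec x.
Proof. by []. Qed.

Lemma natle_trans y x z : x \prec y -> y \prec z -> x \prec z.
Proof.
move=> /natleP[e ee ->] /natleP[f ff ->]; apply/natleP; exists (e * f).
  exact: idemM.
by rewrite mulA.
Qed.

Lemma conj_idem y e : e * e = e -> (y * e * y^-1) * (y * e * y^-1) = y * e * y^-1.
Proof.
move=> ee; rewrite !mulA -(mulA _ (y^-1) y) -(mulA y e).
by rewrite (idem_comm ee (Vmul_idem y)) !mulA smulVK -(mulA y e e) ee.
Qed.

Lemma mul_idemE y e : e * e = e -> y * e = (y * e * y^-1) * y.
Proof.
move=> ee; rewrite -!mulA (idem_comm ee (Vmul_idem y)).
by rewrite !mulA smulVK.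
Qed.

Lemma natleM x x' y y' : x \prec y -> x' \prec y' -> x * x' \prec y * y'.
Proof.
move=> /natleP[e ee ->] /natleP[f ff ->]; apply/natleP.
exists (e * (y * f * y^-1)).
  by apply: idemM => //; exact: conj_idem.
transitivity (e * (y * f) * y'); first by rewrite !mulA.
by rewrite {1}(mul_idemE y ff) !mulA.
Qed.

Lemma natleV x y : x \prec y -> x^-1 \prec y^-1.
Proof.
move=> /natleP[e ee ->]; apply/natleP; exists (y^-1 * e * y).
  by have := conj_idem (y^-1) ee; rewrite sinvK.
by rewrite sinvM (idemV ee) {1}(mul_idemE (y^-1) ee) sinvK.
Qed.

End InvSemigroupTheory.


Section Directed.
Context {T : invSemigroupType}.
Implicit Types A B C : set T.

Definition directed A : Prop :=
  A !=set0 /\ forall x y, A x -> A y ->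
    exists z, [/\ A z, z \prec x & z \prec y].

Definition dirle A B : Prop :=
  forall y, B y -> exists2 x, A x & x \prec y.

Definition mulset A B : set T := [set x * y | x in A & y in B].

Definition invset A : set T := [set x^-1 | x in A].

Lemma directed1 (x : T) : directed [set x].
Proof. by split=> [|_ _ -> ->]; exists x. Qed.

Lemma directedM A B : directed A -> directed B -> directed (mulset A B).
Proof.
move=> [[a Aa] dA] [[b Bb] dB]; split; first by exists (a * b); exists a => //; exists b.
move=> _ _ [x Ax [y By <-]] [x' Ax' [y' By' <-]].
have [z [Az zx zx']] := dA _ _ Ax Ax'; have [w [Bw wy wy']] := dB _ _ By By'.
by exists (z * w); split; [exists z => //; exists w | exact: natleM..].
Qed.

Lemma directedV A : directed A -> directed (invset A).
Proof.
move=> [[a Aa] dA]; split; first by exists (a^-1); exists a.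
move=> _ _ [x Ax <-] [y Ay <-]; have [z [Az zx zy]] := dA _ _ Ax Ay.
by exists (z^-1); split; [exists z | exact: natleV..].
Qed.

Lemma dirle_refl A : dirle A A.
Proof. by move=> x Ax; exists x. Qed.

Lemma dirle_trans B A C : dirle A B -> dirle B C -> dirle A C.
Proof.
move=> AB BC z /BC[y /AB[x Ax xy] yz]; exists x => //; exact: natle_trans yz.
Qed.

Lemma dirleM A A' B B' :
  dirle A B -> dirle A' B' -> dirle (mulset A A') (mulset B B').
Proof.
move=> AB AB' _ [y /AB[x Ax xy] [y' /AB'[x' Ax' xy'] <-]].
by exists (x * x'); [exists x => //; exists x' | exact: natleM].
Qed.

Lemma dirleV A B : dirle A B -> dirle (invset A) (invset B).
Proof.
by move=> AB _ [y /AB[x Ax xy] <-]; exists (x^-1); [exists x | exact: natleV].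
Qed.

End Directed.

Record dirset (T : invSemigroupType) :=
  DirSet { dirset_set :> set T ; dirsetP : directed dirset_set }.

HB.instance Definition _ (T : invSemigroupType) := gen_eqMixin (dirset T).
HB.instance Definition _ (T : invSemigroupType) := gen_choiceMixin (dirset T).

Section OGamma.
Context {T : invSemigroupType}.
Implicit Types A B : dirset T.

Lemma dirset_eq A B : A = B :> set T -> A = B.
Proof.
by case: A B => [A dA] [B dB] /= AB; subst B; rewrite (Prop_irrelevance dA dB).
Qed.

Definition dirset1 (x : T) : dirset T := DirSet (directed1 x).
Definition dirsetM A B : dirset T := DirSet (directedM (dirsetP A) (dirsetP B)).
Definition dirsetV A : dirset T := DirSet (directedV (dirsetP A)).

Definition direqv : rel (dirset T) := fun A B => `[< dirle A B /\ dirle B A >].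

Lemma direqv_refl : reflexive direqv.
Proof. by move=> A; apply/asboolP; split; exact: dirle_refl. Qed.

Lemma direqv_sym : symmetric direqv.
Proof. by move=> A B; apply/asboolP/asboolP => -[]. Qed.

Lemma direqv_trans : transitive direqv.
Proof.
move=> B A C /asboolP[AB BA] /asboolP[BC CB]; apply/asboolP.
by split; [exact: dirle_trans BC | exact: dirle_trans BA].
Qed.

Canonical direqv_equiv := EquivRel direqv direqv_refl direqv_sym direqv_trans.

End OGamma.

Local Open Scope quotient_scope.

Definition dirclass (T : invSemigroupType) := {eq_quot (@direqv T)}.

HB.instance Definition _ T := Choice.on (dirclass T).
HB.instance Definition _ T := EqQuotient.on (dirclass T).

Section DirclassOps.
Context {T : invSemigroupType}.
Implicit Types A B C : dirset T.
Implicit Types X Y : dirclass T.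

(* By [pi_dirclassM] and [pi_dirclassV] below, this is [A][B] = [AB] and
   [A]^-1 = [A^-1] on arbitrary representatives.  *)
Definition dirclassM X Y : dirclass T := \pi_(dirclass T) (dirsetM (repr X) (repr Y)).
Definition dirclassV X : dirclass T := \pi_(dirclass T) (dirsetV (repr X)).

Lemma pi_dirclassE A B :
  \pi_(dirclass T) A = \pi_(dirclass T) B <-> dirle A B /\ dirle B A.
Proof.
split=> [/eqmodP/asboolP//|AB]; apply/eqmodP/asboolP; exact: AB.
Qed.

Lemma repr_dirclass A :
  dirle (repr (\pi_(dirclass T) A)) A /\ dirle A (repr (\pi_(dirclass T) A)).
Proof. by apply/pi_dirclassE; rewrite reprK. Qed.

Lemma pi_dirclassM A B :
  dirclassM (\pi_(dirclass T) A) (\pi_(dirclass T) B) = \pi_(dirclass T) (dirsetM A B).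
Proof.
have [[A1 A2] [B1 B2]] := (repr_dirclass A, repr_dirclass B).
by apply/pi_dirclassE; split; exact: dirleM.
Qed.

Lemma pi_dirclassV A : dirclassV (\pi_(dirclass T) A) = \pi_(dirclass T) (dirsetV A).
Proof.
have [A1 A2] := repr_dirclass A.
by apply/pi_dirclassE; split; exact: dirleV.
Qed.

Lemma dirclass_ind (P : dirclass T -> Prop) :
  (forall A, P (\pi_(dirclass T) A)) -> forall X, P X.
Proof. by move=> PA X; rewrite -[X]reprK. Qed.

Lemma dirclassA : associative dirclassM.
Proof.
move=> X Y Z; elim/dirclass_ind: X => A; elim/dirclass_ind: Y => B.
elim/dirclass_ind: Z => C; rewrite !pi_dirclassM; congr \pi_(dirclass T).
apply: dirset_eq; apply/seteqP; split=> [x|x] /=.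
  move=> [a Aa [_ [b Bb [c Cc <-]] <-]].
  by rewrite monoid.mulgA; exists (a * b); [exists a => //; exists b | exists c].
move=> [_ [a Aa [b Bb <-]] [c Cc <-]].
by rewrite -monoid.mulgA; exists a => //; exists (b * c) => //; exists b => //; exists c.
Qed.

Lemma dirclassVK : involutive dirclassV.
Proof.
elim/dirclass_ind => A; rewrite !pi_dirclassV; congr \pi_(dirclass T).
apply: dirset_eq; apply/seteqP; split=> [_ [_ [a Aa <-] <-]|a Aa] /=.
  by rewrite sinvK.
by exists (a^-1); [exists a | rewrite sinvK].
Qed.

Lemma dirclassVM X Y :
  dirclassV (dirclassM X Y) = dirclassM (dirclassV Y) (dirclassV X).
Proof.
elim/dirclass_ind: X => A; elim/dirclass_ind: Y => B.
rewrite !(pi_dirclassM, pi_dirclassV); congr \pi_(dirclass T).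
apply: dirset_eq; apply/seteqP; split=> [z [w [a Aa [b Bb <-]] <-]|z] /=.
  by rewrite sinvM; exists (b^-1); [exists b | exists (a^-1) => //; exists a].
move=> [w [b Bb <-] [v [a Aa <-] <-]].
by exists (a * b); [exists a => //; exists b | rewrite sinvM].
Qed.

Lemma dirclass_mulVK X : dirclassM (dirclassM X (dirclassV X)) X = X.
Proof.
elim/dirclass_ind: X => A; rewrite !(pi_dirclassM, pi_dirclassV).
have [_ dA] := dirsetP A; apply/pi_dirclassE; split.
  move=> a Aa; exists (a * a^-1 * a); last by rewrite smulVK.
  by exists (a * a^-1); [exists a => //; exists (a^-1) => //; exists a | exists a].
move=> _ [_ [a Aa [_ [b Ab <-] <-]] [c Ac <-]].
have [d [Ad da db]] := dA _ _ Aa Ab; have [e [Ae ed ec]] := dA _ _ Ad Ac.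
exists e => //; rewrite -(smulVK e).
apply: natleM => //; apply: natleM; first exact: natle_trans da.
by apply: natleV; exact: natle_trans db.
Qed.

Lemma dirclass_comm X Y :
  dirclassM (dirclassM X (dirclassV X)) (dirclassM Y (dirclassV Y)) =
  dirclassM (dirclassM Y (dirclassV Y)) (dirclassM X (dirclassV X)).
Proof.
have key A B : dirle (mulset (mulset A (invset A)) (mulset B (invset B)))
                     (mulset (mulset B (invset B)) (mulset A (invset A))).
  have [[_ dA] [_ dB]] := (dirsetP A, dirsetP B).
  move=> _ [_ [c Bc [_ [d Bd <-] <-]] [_ [e Ae [_ [f Af <-] <-]] <-]].
  have [a [Aa ae af]] := dA _ _ Ae Af; have [b [Bb bc bd]] := dB _ _ Bc Bd.
  exists ((a * a^-1) * (b * b^-1)).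
    by exists (a * a^-1); [exists a => //; exists (a^-1) => //; exists a |
      exists (b * b^-1) => //; exists b => //; exists (b^-1) => //; exists b].
  rewrite (idem_comm (mulV_idem a) (mulV_idem b)).
  by apply: natleM; apply: natleM => //; exact: natleV.
elim/dirclass_ind: X => A; elim/dirclass_ind: Y => B.
by rewrite !(pi_dirclassM, pi_dirclassV); apply/pi_dirclassE; split; exact: key.
Qed.

HB.instance Definition _ := isSemigroup.Build (dirclass T) dirclassA.

Lemma dirclass_smulKV X : dirclassV X * X * dirclassV X = dirclassV X.
Proof. by have := dirclass_mulVK (dirclassV X); rewrite dirclassVK. Qed.

HB.instance Definition _ := Semigroup_isInverse.Build (dirclass T)
  dirclass_mulVK dirclass_smulKV
  (inv_unique_of_star dirclassVK dirclassVM dirclass_mulVK dirclass_comm).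

Lemma natle_pi A B : \pi_(dirclass T) A \prec \pi_(dirclass T) B <-> dirle A B.
Proof.
have [[[a0 Aa0] dA] [[b0 Bb0] dB]] := (dirsetP A, dirsetP B).
have VE C : (\pi_(dirclass T) C)^-1 = \pi_(dirclass T) (dirsetV C).
  exact: pi_dirclassV.
have ME C D : \pi_(dirclass T) C * \pi_(dirclass T) D =
    \pi_(dirclass T) (dirsetM C D) by exact: pi_dirclassM.
split=> [/natleP[E EE XE]|AB].
  have {}XE : \pi_(dirclass T) A =
      \pi_(dirclass T) A * (\pi_(dirclass T) A)^-1 * \pi_(dirclass T) B.
    rewrite XE sinvM (idemV EE) -!monoid.mulgA.
    set Y := \pi_(dirclass T) B.
    rewrite (monoid.mulgA Y) (monoid.mulgA E (Y * Y^-1)).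
    rewrite (idem_comm EE (mulV_idem Y)) -!monoid.mulgA (monoid.mulgA E E) EE.
    rewrite (monoid.mulgA Y) (monoid.mulgA (Y * _)) -(idem_comm EE (mulV_idem Y)).
    by rewrite -monoid.mulgA smulVK.
  move: XE; rewrite VE !ME => /pi_dirclassE[AB _] b Bb.
  have /AB[a Aa ab] : mulset (mulset A (invset A)) B (a0 * a0^-1 * b).
    exists (a0 * a0^-1); last by exists b.
    by exists a0 => //; exists (a0^-1) => //; exists a0.
  exists a => //; apply: natle_trans ab _; apply/natleP.
  by exists (a0 * a0^-1) => //; exact: mulV_idem.
rewrite /natle !VE !ME; apply/pi_dirclassE; split.
  move=> _ [a Aa [_ [a' Aa' <-] <-]]; have [a1 Aa1 a1b] := AB _ Bb0.
  have [d [Ad da da']] := dA _ _ Aa Aa'; have [e [Ae ed ea1]] := dA _ _ Ad Aa1.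
  exists (e * b0^-1); first by exists e => //; exists (b0^-1) => //; exists b0.
  rewrite (natle_trans ea1 a1b : e * b0^-1 = e * e^-1).
  by apply: natleM; [exact: natle_trans da | apply: natleV; exact: natle_trans da'].
move=> _ [a Aa [_ [b Bb <-] <-]]; have [a1 Aa1 a1b] := AB _ Bb.
have [d [Ad da da1]] := dA _ _ Aa Aa1; exists (d * d^-1).
  by exists d => //; exists (d^-1) => //; exists d.
by apply: natleM => //; apply: natleV; exact: natle_trans a1b.
Qed.

End DirclassOps.

Definition dirclass1 (T : invSemigroupType) (x : T) : dirclass T :=
  \pi_(dirclass T) (dirset1 x).


(* The product is a total function, whose value is meaningful only on
   composable pairs; [composable x y] is equivalent to
   [gsource x = grange y] (lemma [composableP]).  *)
HB.mixin Record isGroupoid G := {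
  composable : G -> G -> Prop;
  gmul : G -> G -> G;
  ginv : G -> G;
  ginvK : involutive ginv;
  gmulA : forall x y z : G, composable x y -> composable y z ->
    [/\ composable (gmul x y) z, composable x (gmul y z) &
        gmul (gmul x y) z = gmul x (gmul y z)];
  composableV : forall x : G, composable x (ginv x);
  gmulKV : forall x y : G, composable x y -> gmul (ginv x) (gmul x y) = y;
  gmulVK : forall x y : G, composable x y -> gmul (gmul x y) (ginv y) = x
}.

#[short(type="groupoidType")]
HB.structure Definition Groupoid := {G of isGroupoid G}.

Arguments gmulA {s} [x y z].
Arguments gmulKV {s} [x y].
Arguments gmulVK {s} [x y].

Definition grange (G : groupoidType) (x : G) : G := gmul x (ginv x).
Definition gsource (G : groupoidType) (x : G) : G := gmul (ginv x) x.

#[short(type="preTopologicalGroupoidType")]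
HB.structure Definition PreTopologicalGroupoid :=
  {G of Topological G & Groupoid G}.

Definition is_topological_groupoid (G : preTopologicalGroupoidType) : Prop :=
  continuous (@ginv G) /\
  {within [set p : G * G | composable p.1 p.2],
     continuous (fun p : G * G => gmul p.1 p.2)}.

Section GroupoidTheory.
Context {G : groupoidType}.
Implicit Types x y z : G.

Lemma composableP x y : composable x y <-> gsource x = grange y.
Proof.
have cV z : composable (ginv z) z by have := composableV (ginv z); rewrite ginvK.
split=> [xy|sr].
  have [c1 c2 _] := gmulA (cV x) xy.
  have [_ _ E] := gmulA c2 (composableV (gmul x y)).
  have [c3 c4 _] := gmulA xy (composableV y).
  have [_ _ E'] := gmulA c2 c3.
  by rewrite /gsource /grange -{1}(gmulKV xy) E' (gmulVK xy).
have [_ xs _] := gmulA (composableV x) (cV x).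
have [ry _ _] := gmulA (composableV y) (cV y).
have [c _ _] : [/\ composable (gmul x (gsource x)) y,
   composable x (gmul (gsource x) y) &
   gmul (gmul x (gsource x)) y = gmul x (gmul (gsource x) y)].
  by apply: gmulA => //; rewrite sr.
have [_ _ E] := gmulA (composableV x) (cV x).
by move: c; rewrite /gsource -E -[X in gmul _ X]ginvK (gmulVK (composableV x)).
Qed.

Lemma grangeV x : grange (ginv x) = gsource x.
Proof. by rewrite /grange ginvK. Qed.

Lemma gsourceV x : gsource (ginv x) = grange x.
Proof. by rewrite /gsource ginvK. Qed.

Lemma composableVl x : composable (ginv x) x.
Proof. by apply/composableP; rewrite gsourceV. Qed.

Lemma composableVV x y : composable x y -> composable (ginv y) (ginv x).
Proof. by move=> /composableP xy; apply/composableP; rewrite gsourceV grangeV. Qed.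

Lemma gmul_source x : gmul x (gsource x) = x.
Proof.
have [_ _ <-] := gmulA (composableV x) (composableVl x).
by rewrite -{3}(ginvK x) (gmulVK (composableV x)).
Qed.

Lemma gmul_range x : gmul (grange x) x = x.
Proof.
by rewrite -{3}(gmulVK (composableV x)) ginvK.
Qed.

Lemma grangeM x y : composable x y -> grange (gmul x y) = grange x.
Proof.
move=> xy; apply/esym; rewrite -(gsourceV x); apply/composableP.
by have [] := gmulA (composableVl x) xy.
Qed.

Lemma gsourceM x y : composable x y -> gsource (gmul x y) = gsource y.
Proof.
move=> xy; rewrite -(grangeV y); apply/composableP.
by have [] := gmulA xy (composableV y).
Qed.

Lemma ginvM x y : composable x y -> ginv (gmul x y) = gmul (ginv y) (ginv x).
Proof.
move=> xy; have cVV := composableVV xy.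
have c : composable (ginv (gmul x y)) x.
  by apply/composableP; rewrite gsourceV grangeM.
have E : gmul (ginv (gmul x y)) x = ginv y.
  have c2 : composable (gmul x y) (ginv y).
    by apply/composableP; rewrite gsourceM // grangeV.
  by rewrite -{2}(gmulVK xy) (gmulKV c2).
by rewrite -E (gmulVK c).
Qed.

Lemma grange_source x : grange (gsource x) = gsource x.
Proof. by rewrite -[X in grange X]/(gmul _ _) grangeM ?grangeV//; exact: composableVl. Qed.

Lemma gsource_source x : gsource (gsource x) = gsource x.
Proof. by rewrite -[X in gsource X]/(gmul _ _) gsourceM//; exact: composableVl. Qed.

Lemma gsource_range x : gsource (grange x) = grange x.
Proof. by rewrite -(gsourceV x) gsource_source. Qed.

Lemma grange_range x : grange (grange x) = grange x.
Proof. by rewrite -(gsourceV x) grange_source. Qed.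

End GroupoidTheory.


Section Gsets.
Context {G : groupoidType}.
Implicit Types A B C : set G.

Definition is_gset A : Prop :=
  {in A &, injective (@grange G)} /\ {in A &, injective (@gsource G)}.

Definition gmulset A B : set G :=
  [set c | exists a b, [/\ A a, B b, composable a b & c = gmul a b]].

Definition ginvset A : set G := [set ginv a | a in A].

Lemma is_gsetP A : is_gset A <->
  (forall x y, A x -> A y -> grange x = grange y -> x = y) /\
  (forall x y, A x -> A y -> gsource x = gsource y -> x = y).
Proof.
split=> -[Ar As].
  by split=> x y Ax Ay; [apply: Ar | apply: As]; rewrite ?inE.
by split=> x y; rewrite !inE => Ax Ay; [exact: Ar | exact: As].
Qed.

Lemma is_gsetM A B : is_gset A -> is_gset B -> is_gset (gmulset A B).
Proof.
move=> /is_gsetP[Ar As] /is_gsetP[Br Bs]; apply/is_gsetP; split.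
  move=> _ _ [a [b [Aa Bb ab ->]]] [c [d [Ac Bd cd ->]]].
  rewrite !grangeM// => /(Ar _ _ Aa Ac) ac; subst c; congr gmul.
  by apply: Br => //; move/composableP: ab => <-; move/composableP: cd => <-.
move=> _ _ [a [b [Aa Bb ab ->]]] [c [d [Ac Bd cd ->]]].
rewrite !gsourceM// => /(Bs _ _ Bb Bd) bd; subst d; congr gmul.
by apply: As => //; move/composableP: ab => ->; move/composableP: cd => ->.
Qed.

Lemma is_gsetV A : is_gset A -> is_gset (ginvset A).
Proof.
move=> /is_gsetP[Ar As]; apply/is_gsetP; split.
  by move=> _ _ [a Aa <-] [b Ab <-]; rewrite !grangeV => /(As _ _ Aa Ab) ->.
by move=> _ _ [a Aa <-] [b Ab <-]; rewrite !gsourceV => /(Ar _ _ Aa Ab) ->.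
Qed.

End Gsets.

Record gset (G : groupoidType) :=
  Gset { gset_set :> set G ; gsetP : is_gset gset_set }.

HB.instance Definition _ (G : groupoidType) := gen_eqMixin (gset G).
HB.instance Definition _ (G : groupoidType) := gen_choiceMixin (gset G).

Section GsetInvSemigroup.
Context {G : groupoidType}.
Implicit Types A B C : gset G.

Lemma gset_eq A B : A = B :> set G -> A = B.
Proof.
by case: A B => [A gA] [B gB] /= AB; subst B; rewrite (Prop_irrelevance gA gB).
Qed.

Definition gsetM A B : gset G := Gset (is_gsetM (gsetP A) (gsetP B)).
Definition gsetV A : gset G := Gset (is_gsetV (gsetP A)).

Lemma gsetA : associative gsetM.
Proof.
move=> A B C; apply: gset_eq; apply/seteqP; split=> x /=.
  move=> [a [_ [Aa [b [c [Bb Cc bc ->]]] abc ->]]].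
  have ab : composable a b.
    by apply/composableP; rewrite -(grangeM bc); apply/composableP.
  have [abc' _ E] := gmulA ab bc.
  by exists (gmul a b), c; split=> //; exists a, b.
move=> [_ [c [[a [b [Aa Bb ab ->]]] Cc abc ->]]].
have bc : composable b c.
  by apply/composableP; rewrite -(gsourceM ab); apply/composableP.
have [_ abc' E] := gmulA ab bc.
by exists a, (gmul b c); split=> //; exists b, c.
Qed.

Lemma gsetVK : involutive gsetV.
Proof.
move=> A; apply: gset_eq; apply/seteqP; split=> [_ [_ [a Aa <-] <-]|a Aa] /=.
  by rewrite ginvK.
by exists (ginv a); [exists a | rewrite ginvK].
Qed.

Lemma gsetVM A B : gsetV (gsetM A B) = gsetM (gsetV B) (gsetV A).
Proof.
apply: gset_eq; apply/seteqP; split.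
  move=> _ [_ [a [b [Aa Bb ab ->]]] <-].
  by exists (ginv b), (ginv a); split;
    [exists b | exists a | exact: composableVV | exact: ginvM].
move=> _ [_ [_ [[b Bb <-] [a Aa <-] ba ->]]].
have ab : composable a b by have := composableVV ba; rewrite !ginvK.
by exists (gmul a b); [exists a, b | rewrite ginvM].
Qed.

Lemma gsetMV A : gsetM A (gsetV A) = [set grange a | a in A] :> set G.
Proof.
have /is_gsetP[_ As] := gsetP A; apply/seteqP; split.
  move=> _ [a [_ [Aa [b Ab <-] /composableP ab ->]]]; exists a => //.
  by rewrite grangeV in ab; rewrite (As _ _ Aa Ab ab).
move=> _ [a Aa <-]; exists a, (ginv a); split=> //; first by exists a.
exact: composableV.
Qed.

Lemma gset_mulVK A : gsetM (gsetM A (gsetV A)) A = A.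
Proof.
have /is_gsetP[Ar _] := gsetP A.
apply: gset_eq; apply/seteqP; split=> [x [u [a []]]|a Aa].
  rewrite gsetMV => -[b Ab <-] Aa /composableP.
  rewrite gsource_range => ba ->.
  by rewrite (Ar _ _ Ab Aa ba) gmul_range.
exists (grange a), a; split=> //.
- by rewrite gsetMV; exists a.
- by apply/composableP; rewrite gsource_range.
- by rewrite gmul_range.
Qed.

Lemma gset_comm A B :
  gsetM (gsetM A (gsetV A)) (gsetM B (gsetV B)) =
  gsetM (gsetM B (gsetV B)) (gsetM A (gsetV A)).
Proof.
have key C D : gsetM (gsetM C (gsetV C)) (gsetM D (gsetV D)) `<=`
    gsetM (gsetM D (gsetV D)) (gsetM C (gsetV C)).
  move=> w [u [v []]]; rewrite !gsetMV => -[c Cc <-] [d Dd <-] + ->.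
  move=> cd; have /composableP := cd.
  rewrite gsource_range grange_range => E.
  exists (grange d), (grange c); split.
  - by rewrite gsetMV; exists d.
  - by rewrite gsetMV; exists c.
  - by apply/composableP; rewrite gsource_range grange_range.
  - by rewrite E.
by apply: gset_eq; apply/seteqP; split; exact: key.
Qed.

HB.instance Definition _ := isSemigroup.Build (gset G) gsetA.

Lemma gset_mulKV A : gsetV A * A * gsetV A = gsetV A.
Proof. by have := gset_mulVK (gsetV A); rewrite gsetVK. Qed.

HB.instance Definition _ := Semigroup_isInverse.Build (gset G)
  gset_mulVK gset_mulKV
  (inv_unique_of_star gsetVK gsetVM gset_mulVK gset_comm).

End GsetInvSemigroup.


Definition Gu (T : invSemigroupType) : Type := dirclass T.

HB.instance Definition _ (T : invSemigroupType) := Choice.on (Gu T).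

Section GuGroupoid.
Context {T : invSemigroupType}.
Implicit Types X Y Z : dirclass T.

Definition Gu_composable (X Y : dirclass T) : Prop := X^-1 * X = Y * Y^-1.

Let mulA := @monoid.mulgA (dirclass T).

Lemma Gu_gmulA X Y Z : Gu_composable X Y -> Gu_composable Y Z ->
  [/\ Gu_composable (X * Y) Z, Gu_composable X (Y * Z) &
      X * Y * Z = X * (Y * Z)].
Proof.
rewrite /Gu_composable => XY YZ; split; last by rewrite mulA.
  rewrite sinvM -mulA (mulA (X^-1)) XY -YZ.
  by rewrite !mulA smulKV.
by rewrite sinvM -mulA (mulA Z) -YZ XY !mulA smulVK.
Qed.

Lemma Gu_composableV X : Gu_composable X (X^-1).
Proof. by rewrite /Gu_composable sinvK. Qed.

Lemma Gu_gmulKV X Y : Gu_composable X Y -> X^-1 * (X * Y) = Y.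
Proof. by rewrite mulA => ->; exact: smulVK. Qed.

Lemma Gu_gmulVK X Y : Gu_composable X Y -> X * Y * Y^-1 = X.
Proof. by rewrite -mulA => <-; rewrite mulA smulVK. Qed.

HB.instance Definition _ := isGroupoid.Build (Gu T)
  (@sinvK (dirclass T)) Gu_gmulA Gu_composableV Gu_gmulKV Gu_gmulVK.

End GuGroupoid.

Definition Uset (T : invSemigroupType) (x : T) : set (Gu T) :=
  [set X : dirclass T | X \prec dirclass1 x].

Definition Ubasic (T : invSemigroupType) (x : T) (s : seq T) : set (Gu T) :=
  Uset x `&` \bigcap_(y in [set` s]) ~` Uset y.

Definition Ufamily (T : invSemigroupType) : set (set (Gu T)) :=
  [set Ubasic p.1 p.2 |
     p in [set p : T * seq T | forall y, y \in p.2 -> y \prec p.1]].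

Arguments Ufamily T : clear implicits.

(* The topology generated by the sets [Ubasic x s]; that its open sets are
   exactly the unions of such sets is not built in.  *)
HB.instance Definition _ (T : invSemigroupType) :=
  isSubBaseTopological.Build (Gu T) (Ufamily T) id.


(* The values of the inverse [g] outside of [f @` A] are irrelevant.  *)
Definition homeo_onto_image (T : topologicalType) (f : T -> T) (A : set T) :
    Prop :=
  {within A, continuous f} /\
  exists2 g : T -> T, {in A, cancel f g} & {within f @` A, continuous g}.

(* Main.v *)
Require Import Defs.
From HB Require Import structures.
From mathcomp Require Import all_boot.
From mathcomp Require Import all_classical topology.

(* Two elements y, z below a common x have the meet z z^-1 y, so that
   U_y `&` U_z = U_(z z^-1 y); this makes the sets U_(x; x_1, ..., x_n) a basis.
   If Y \prec b, then X Y \prec w iff X \prec w b^-1 for composable X, Y; hence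
   preimages of basic sets under the groupoid operations and under the inverses
   of r and s on U_x are locally basic sets, which gives all continuity claims.
   For compactness, an ultrafilter F containing U_(x; x_1, ..., x_n) converges to
   the class of the directed set {z \prec x | U_z belongs to F}. *)

Set Implicit Arguments.
Unset Strict Implicit.
Unset Printing Implicit Defensive.

Local Open Scope classical_set_scope.
Local Open Scope invsemigroup_scope.

(** * Meets, division and factorization in the natural order *)

Section NaturalOrder.
Context {S : invSemigroupType}.
Implicit Types x y z w e d b : S.

Let mulA := @monoid.mulgA S.

Lemma natle_mull e x : e * e = e -> e * x \prec x.
Proof. by move=> ee; apply/natleP; exists e. Qed.

Lemma natle_mulr e x : e * e = e -> x * e \prec x.
Proof.
by move=> ee; rewrite mul_idemE//; apply: natle_mull; exact: conj_idem.
Qed.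

(** Below a fixed [y], an element is determined by its range idempotent; this is what inverts
    [grange] on [Uset y]. *)
Lemma natle_mulVl x y : x \prec y -> x * x^-1 * y = x.
Proof.
move=> /natleP[e ee ->]; rewrite sinvM (idemV ee) -!mulA (mulA y).
rewrite (mulA (y * _)) (idem_comm (mulV_idem y) ee) -!mulA (mulA e e) ee.
by rewrite (mulA y) smulVK.
Qed.

Lemma natle_anti x y : x \prec y -> y \prec x -> x = y.
Proof.
move=> /natleP[e ee xE] /natleP[f ff yE].
by rewrite {1}xE yE mulA (idem_comm ee ff) -mulA {1}xE (mulA e e) ee -xE.
Qed.

Lemma natle_meetl x y z : y \prec x -> z \prec x -> z * z^-1 * y \prec z.
Proof. by move=> yx zx; rewrite -{3}(natle_mulVl zx); exact: natleM. Qed.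

Lemma natle_meetr y z : z * z^-1 * y \prec y.
Proof. exact/natle_mull/mulV_idem. Qed.

Lemma natle_meet x y z d : y \prec x -> z \prec x ->
  (d \prec z * z^-1 * y <-> d \prec z /\ d \prec y).
Proof.
move=> yx zx; split=> [dm|[dz dy]]; last first.
  (* Write [d] as [d * d^-1 * d] and bound the three factors by [z], [z^-1] and [y]. *)
  by rewrite -(smulVK d); do 2 apply: natleM => //; exact: natleV.
split; apply: natle_trans dm _; [exact: natle_meetl zx | exact: natle_meetr].
Qed.

(* Translating by [y] is replaced by translating by the fixed element [b]
   above it: this makes preimages of the sets [Uset w] under the groupoid
   operations locally of the same form. *)
Lemma natle_divr x y b w : y \prec b -> x * y * y^-1 = x ->
  (x * y \prec w <-> x \prec w * b^-1).
Proof.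
move=> yb xyy; split=> [xyw|xwb].
  by rewrite -xyy; apply: natleM => //; exact: natleV.
apply: (natle_trans (natleM xwb yb)); rewrite -mulA.
exact/natle_mulr/Vmul_idem.
Qed.

Lemma natle_divl x y b w : x \prec b -> x^-1 * (x * y) = y ->
  (x * y \prec w <-> y \prec b^-1 * w).
Proof.
move=> xb xxy; split=> [xyw|ybw].
  by rewrite -xxy; apply: natleM => //; exact: natleV.
apply: (natle_trans (natleM xb ybw)); rewrite mulA.
exact/natle_mull/mulV_idem.
Qed.

Lemma natle_factor x y z : z \prec x * y ->
  [/\ z * z^-1 * x \prec x, x^-1 * z \prec y,
      (z * z^-1 * x)^-1 * (z * z^-1 * x) = (x^-1 * z) * (x^-1 * z)^-1 &
      z * z^-1 * x * (x^-1 * z) = z].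
Proof.
move=> zxy; have xxz : x * (x^-1 * z) = z.
  have zE := natle_mulVl zxy.
  transitivity (x * x^-1 * (z * z^-1) * (x * y)).
    by rewrite -(mulA (x * _)) zE mulA.
  rewrite (idem_comm (mulV_idem x) (mulV_idem z)) -mulA.
  by rewrite (mulA (x * _)) smulVK.
split; last by rewrite -mulA xxz smulVK.
- exact: natle_meetr.
- apply: natle_trans (natleM (natle_refl _) zxy) _; rewrite mulA.
  exact/natle_mull/Vmul_idem.
- by rewrite !sinvM !sinvK -!mulA (mulA (z^-1) z) (mulA (z^-1 * z)) smulKV.
Qed.

Lemma natleVl x y : x^-1 \prec y <-> x \prec y^-1.
Proof. by split=> /natleV; rewrite sinvK. Qed.

End NaturalOrder.

(** * Principal classes and the sets [Uset x] *)

Section PrincipalClasses.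
Context {T : invSemigroupType}.
Implicit Types (X Y : dirclass T) (x y z : T).

Local Open Scope quotient_scope.

Lemma natle_dirclass1 x y : dirclass1 x \prec dirclass1 y <-> x \prec y.
Proof.
by split=> [/natle_pi/(_ y erefl)[_ ->]|xy] //; apply/natle_pi => _ ->; exists x.
Qed.

Lemma dirclass1M x y : dirclass1 (x * y) = dirclass1 x * dirclass1 y.
Proof.
apply/esym; rewrite /dirclass1; apply: etrans (pi_dirclassM _ _) _.
congr (\pi_ _ _); apply: dirset_eq; apply/seteqP.
split=> [_ [_ -> [_ -> <-]]|_ ->] //.
by exists x => //; exists y.
Qed.

Lemma dirclass1V x : dirclass1 (x^-1) = (dirclass1 x)^-1.
Proof.
apply/esym; rewrite /dirclass1; apply: etrans (pi_dirclassV _) _.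
congr (\pi_ _ _); apply: dirset_eq; apply/seteqP; split=> [_ [_ -> <-]|_ ->] //.
by exists x.
Qed.

Lemma dirclass_ub X : exists x, X \prec dirclass1 x.
Proof.
elim/(@dirclass_ind T): X => A; have [[a Aa] _] := dirsetP A.
by exists a; apply/natle_pi => _ ->; exists a.
Qed.

(** Directedness of a representative of [X], carried over to the principal classes above [X]. *)
Lemma dirclass_lb X x y : X \prec dirclass1 x -> X \prec dirclass1 y ->
  exists z, [/\ X \prec dirclass1 z, z \prec x & z \prec y].
Proof.
elim/(@dirclass_ind T): X => A /natle_pi/(_ x erefl)[a Aa ax].
move=> /natle_pi/(_ y erefl)[b Ab bx].
have [z [Az za zb]] := (dirsetP A).2 _ _ Aa Ab.
exists z; split; [|exact: natle_trans ax|exact: natle_trans bx].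
by apply/natle_pi => _ ->; exists z.
Qed.

Lemma subset_Uset x y : x \prec y -> Uset x `<=` Uset y.
Proof. by move=> xy X /natle_trans; apply; apply/natle_dirclass1. Qed.

Lemma Uset_meet x y z : y \prec x -> z \prec x ->
  Uset (z * z^-1 * y) = Uset z `&` Uset y.
Proof.
move=> /natle_dirclass1 yx /natle_dirclass1 zx; apply/seteqP; split=> X;
  by rewrite /Uset /= !dirclass1M dirclass1V => /(natle_meet _ yx zx).
Qed.

Lemma UbasicP x s X :
  Ubasic x s X <-> Uset x X /\ forall y, y \in s -> ~ Uset y X.
Proof. by []. Qed.

Lemma UfamilyP x s : (forall y, y \in s -> y \prec x) -> Ufamily T (Ubasic x s).
Proof. by move=> sx; exists (x, s). Qed.

(** Stated for two points, so that it serves both for a map on a subset and for a product whose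
    other factor stays in a fixed [Uset b]. *)
Lemma Ubasic_map (phi : T -> T) (X Y : Gu T) x s :
  (forall w, Uset w Y <-> Uset (phi w) X) ->
  Ubasic x s Y <-> Ubasic (phi x) (map phi s) X.
Proof.
move=> phiE; rewrite !UbasicP phiE; split=> -[? XY]; split=> //.
  by move=> _ /mapP[y ys ->] /phiE; exact: XY.
by move=> y ys /phiE; apply: XY; exact: map_f.
Qed.

(** Only the part of [Uset y] inside [Uset z] matters when it is removed from [Uset z]. Replacing
    [y] by its meet with [z] brings the excluded elements below [z], as [Ufamily] demands. *)
Lemma Ubasic_meet z s :
  (forall y, y \in s -> exists2 x, y \prec x & z \prec x) ->
  Ubasic z s = Ubasic z [seq z * z^-1 * y | y <- s].
Proof.
move=> sz; apply/seteqP; split=> X /UbasicP[zX sX]; apply/UbasicP; split=> //.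
  move=> _ /mapP[y ys ->]; have [x yx zx] := sz _ ys.
  by rewrite (Uset_meet yx zx) => -[_]; exact: sX.
move=> y ys yX; have [x yx zx] := sz _ ys; apply: (sX (z * z^-1 * y)).
  exact: (map_f (fun y => z * z^-1 * y)).
by rewrite (Uset_meet yx zx).
Qed.

End PrincipalClasses.

(** * The basis of the topology *)

Section GuTopology.
Context {T : invSemigroupType}.
Implicit Types (X Y : Gu T) (V W : set (Gu T)) (x y z : T).

Lemma Ufamily_cover X : exists2 V, Ufamily T V & V X.
Proof.
have [x Xx] := dirclass_ub X.
by exists (Ubasic x [::]); [exact: UfamilyP | apply/UbasicP].
Qed.

Lemma Ufamily_join V W X : Ufamily T V -> Ufamily T W -> V X -> W X ->
  exists B, [/\ Ufamily T B, B X & B `<=` V `&` W].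
Proof.
move=> [[x s] /= sx <-] [[y t] /= ty <-] /UbasicP[Xx Xs] /UbasicP[Xy Xt].
have [z [Xz zx zy]] := dirclass_lb Xx Xy.
have stz w : w \in s ++ t -> exists2 u, w \prec u & z \prec u.
  by rewrite mem_cat => /orP[/sx|/ty]; [exists x | exists y].
exists (Ubasic z (s ++ t)); split.
- rewrite (Ubasic_meet stz); apply: UfamilyP => _ /mapP[w ws ->].
  have [u wu zu] := stz _ ws.
  exact: natle_meetl wu zu.
- apply/UbasicP; split=> // w; rewrite mem_cat => /orP[]; [exact: Xs|exact: Xt].
- move=> Y /UbasicP[Yz Yst]; split; apply/UbasicP; split.
  + exact: subset_Uset Yz.
  + by move=> w ws; apply: Yst; rewrite mem_cat ws.
  + exact: subset_Uset Yz.
  + by move=> w ws; apply: Yst; rewrite mem_cat ws orbT.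
Qed.

Lemma Ufamily_bigcap (s : seq (set (Gu T))) X :
  (forall V, V \in s -> Ufamily T V /\ V X) ->
  exists B, [/\ Ufamily T B, B X & forall V, V \in s -> B `<=` V].
Proof.
elim: s => [_|V s IHs VsX].
  by have [B UB BX] := Ufamily_cover X; exists B.
have [|B [UB BX Bs]] := IHs.
  by move=> W Ws; apply: VsX; rewrite inE Ws orbT.
have [UV VX] := VsX V (mem_head _ _).
have [C [UC CX CVB]] := Ufamily_join UV UB VX BX.
exists C; split=> // W; rewrite inE => /orP[/eqP-> Y /CVB[]//|Ws Y /CVB[_]].
exact: Bs.
Qed.

Lemma Gu_openE V : open V <->
  exists2 F : set (set (Gu T)), F `<=` Ufamily T & V = \bigcup_(B in F) B.
Proof.
split=> [[F FI <-]|[F FU ->]]; last first.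
  exists F => //; first by move=> B /FU UB; exact: finI_from1.
exists [set B | Ufamily T B /\ B `<=` \bigcup_(C in F) C]; first by move=> B [].
apply/seteqP; split=> [X [C FC CX]|X [B [_ BF] BX]]; last exact: BF.
(* [C] is the intersection of the finite family [E] of basic sets, so a basic set fits between [X]
   and [C]. *)
have [E EU CE] := FI _ FC.
suff [B [UB BX BC]] : exists B, [/\ Ufamily T B, B X & B `<=` C].
  by exists B => //; split=> // Y /BC CY; exists C.
have [|B [UB BX BE]] := @Ufamily_bigcap (finmap.enum_fset E) X.
  by move=> W WE; rewrite -CE in CX; split; [exact/set_mem/EU|exact: CX].
by exists B; split=> //; rewrite -CE => Y BY W /BE; exact.
Qed.

Lemma basis_Ufamily : basis (Ufamily T).
Proof.
split=> [B UB|X V].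
  by apply/Gu_openE; exists [set B]; [move=> _ ->|rewrite bigcup_set1].
rewrite nbhsE => -[W [/Gu_openE[F FU ->] [B FB BX] BV]].
exists B; first by split=> //; exact: FU.
by move=> Y BY; apply: BV; exists B.
Qed.

Lemma nbhs_UbasicP X (P : set (Gu T)) : nbhs X P <->
  exists x s, [/\ forall y, y \in s -> y \prec x, Ubasic x s X &
                  Ubasic x s `<=` P].
Proof.
split=> [/(basis_Ufamily.2 X)[_ [[[x s] /= sx <-] Xxs] xsP]|].
  by exists x, s.
move=> [x [s [sx Xxs xsP]]].
apply: filterS xsP _; apply: open_nbhs_nbhs; split=> //.
exact/basis_Ufamily.1/UfamilyP.
Qed.

Lemma nbhs_Uset x X : Uset x X -> nbhs X (Uset x).
Proof. by move=> Xx; apply/nbhs_UbasicP; exists x, [::]; split=> // Y []. Qed.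

(** Monotonicity of [phi] keeps the excluded elements below the main one, so basic sets pull back to
    basic sets within [A]. *)
Lemma continuous_Uset (f : Gu T -> Gu T) (A : set (Gu T)) (phi : T -> T) :
  {homo phi : x y / x \prec y} ->
  (forall X, A X -> forall w, Uset w (f X) <-> Uset (phi w) X) ->
  {within A, continuous f}.
Proof.
move=> phi_homo fphi; apply/subspace_continuousP => X AX P.
move=> /nbhs_UbasicP[w [s [sw fXws wsP]]].
apply/nbhs_UbasicP; exists (phi w), (map phi s); split.
- by move=> _ /mapP[y /sw yw ->]; exact: phi_homo.
- by apply/(Ubasic_map _ _ (fphi X AX)).
- by move=> Y Yws AY; apply: wsP; apply/(Ubasic_map _ _ (fphi Y AY)).
Qed.

(** * Continuity of inversion and multiplication *)

Lemma Uset_ginv x X : Uset x (ginv X) <-> Uset (x^-1) X.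
Proof. by rewrite /Uset /= dirclass1V; exact: natleVl. Qed.

Lemma Uset_gmulr b w (X Y : Gu T) : composable X Y -> Uset b Y ->
  Uset w (gmul X Y) <-> Uset (w * b^-1) X.
Proof.
move=> XY Yb; rewrite /Uset /= dirclass1M dirclass1V.
exact: natle_divr Yb (Gu_gmulVK XY).
Qed.

Lemma Uset_gmull b w X Y : composable X Y -> Uset b X ->
  Uset w (gmul X Y) <-> Uset (b^-1 * w) Y.
Proof.
move=> XY Xb; rewrite /Uset /= dirclass1M dirclass1V.
exact: natle_divl Xb (Gu_gmulKV XY).
Qed.

Lemma Gu_is_topological_groupoid : is_topological_groupoid (Gu T).
Proof.
split.
  apply/continuous_subspace_setT; apply: (@continuous_Uset _ _ sinv).
    by move=> x y; exact: natleV.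
  by move=> X _ w; exact: Uset_ginv.
apply/subspace_continuousP => -[X Y] /= XY P.
move=> /nbhs_UbasicP[w [s [sw XYws wsP]]].
(* The same [b] serves for every second factor in the neighbourhood [Uset b] of [Y], so the
   condition on the product becomes one on the first factor alone. *)
have [b Yb] := dirclass_ub Y.
exists (Ubasic (w * b^-1) [seq y * b^-1 | y <- s], Uset b) => /=.
  split; last exact: nbhs_Uset.
  apply/nbhs_UbasicP; exists (w * b^-1), [seq y * b^-1 | y <- s]; split=> //.
    by move=> _ /mapP[y /sw yw ->]; exact: natleM.
  by apply/(Ubasic_map _ _ (fun w => Uset_gmulr w XY Yb)).
move=> [X' Y'] [/= X'wb Y'b] XY'; apply: wsP.
by apply/(Ubasic_map _ _ (fun w => Uset_gmulr w XY' Y'b)).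
Qed.

(** * Compactness of the basic sets *)

Lemma compact_Ubasic x s : (forall y, y \in s -> y \prec x) ->
  compact (Ubasic x s).
Proof.
move=> sx; rewrite compact_ultra => F FU Fxs.
pose A := [set z | z \prec x /\ F (Uset z)].
have FUx : F (Uset x) by apply: filterS Fxs => X [].
(* The common bound [w] is arbitrary: it is [x] for directedness, and the centre of a basic
   neighbourhood of the limit at the end. *)
have meetA w z y : A z -> z \prec w -> y \prec w -> F (Uset y) ->
    A (z * z^-1 * y).
  move=> [zx Fz] zw yw Fy; split; last first.
    by rewrite (Uset_meet yw zw); exact: filterI.
  exact: natle_trans (natle_meetl yw zw) zx.
have dirA : directed A.
  split; first by exists x.
  move=> z y Az [yx Fy]; exists (z * z^-1 * y).
  split; first exact: meetA Az.1 yx Fy.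
    exact: natle_meetl yx Az.1.
  exact: natle_meetr.
pose X : Gu T := \pi_(dirclass T)%qT (DirSet dirA).
have XP y : Uset y X <-> exists2 z, A z & z \prec y.
  split=> [/natle_pi/(_ y erefl)//|[z Az zy]].
  by apply/natle_pi => _ ->; exists z.
exists X; split.
  apply/UbasicP; split; first by apply/XP; exists x.
  (* Otherwise [Uset z], a member of [F] contained in [Uset y], would be disjoint from [Ubasic x s],
     also a member of [F]. *)
  move=> y ys /XP[z [zx Fz] zy].
  have [Y [Yz /UbasicP[_ /(_ y ys)]]] := filter_ex (filterI Fz Fxs).
  by apply; exact: subset_Uset Yz.
move=> P /nbhs_UbasicP[w [t [tw /UbasicP[/XP[z Az zw] Xt] wtP]]].
apply: filterS wtP _; apply: filterI.
  by apply: filterS Az.2; exact: subset_Uset.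
rewrite bigcap_seq big_seq; elim/big_ind: _ => [||y yt].
- exact: filterT.
- by move=> V W; exact: filterI.
(* If [F] contained [Uset y], the meet of [y] and [z] would lie in [A] and put the limit in the
   excluded set [Uset y]. *)
have [Fy|//] := in_ultra_setVsetC (Uset y) FU.
case: (Xt y yt); apply/XP; exists (z * z^-1 * y); last exact: natle_meetr.
exact: meetA Az zw (tw y yt) Fy.
Qed.

(** A nonempty [A] supplies the base point with which [compact_cover] is applied. *)
Lemma compact_cover_compact (X : topologicalType) (A : set X) :
  compact A -> cover_compact A.
Proof.
have [->|/set0P[p _]] := eqVneq A set0.
  by move=> _ I D f _ _; exists (finmap.fset0).
pose PX : ptopologicalType := HB.pack (Topological.sort X) (isPointed.Build X p).
by move=> cA; have : @compact PX A := cA; rewrite compact_cover.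
Qed.

(** * Range and source on the basic sets *)

Lemma grangeK x X : Uset x X -> (grange X : dirclass T) * dirclass1 x = X.
Proof. exact: natle_mulVl. Qed.

Lemma gsourceK x X : Uset x X -> dirclass1 x * (gsource X : dirclass T) = X.
Proof.
move=> /natleV/natle_mulVl/(congr1 sinv).
by rewrite !sinvM !sinvK => XE; rewrite -[RHS]XE.
Qed.

Lemma is_gset_Ubasic x s : is_gset (@Ubasic T x s).
Proof.
apply/is_gsetP; split=> X Y [Xx _] [Yx _] XY.
  by rewrite -(grangeK Xx) XY grangeK.
by rewrite -(gsourceK Xx) XY gsourceK.
Qed.

Lemma homeo_grange x s : homeo_onto_image (@grange (Gu T)) (Ubasic x s).
Proof.
split.
  apply: (@continuous_Uset _ _ (fun w => w * x)).
    by move=> y z yz; exact: natleM.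
  (* The second factor of [grange X] is [ginv X], which lies in [Uset (x^-1)]; division by [x^-1] is
     multiplication by [x]. *)
  move=> X [Xx _] w; rewrite -[x in X in _ <-> X]sinvK.
  apply: Uset_gmulr (composableV X) _.
  by rewrite Uset_ginv sinvK.
exists (fun Y : dirclass T => Y * dirclass1 x).
  by move=> X /set_mem[/grangeK].
apply: (@continuous_Uset _ _ (fun w => w * x^-1)).
  by move=> y z yz; exact: natleM.
move=> _ [X [Xx _] <-] w; rewrite /Uset /= dirclass1M dirclass1V.
(* What remains, that [X] times the inverse of [dirclass1 x] is [grange X], is the definition of
   [X \prec dirclass1 x]. *)
by apply: natle_divr => //; rewrite (grangeK Xx).
Qed.

Lemma homeo_gsource x s : homeo_onto_image (@gsource (Gu T)) (Ubasic x s).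
Proof.
split.
  apply: (@continuous_Uset _ _ (fun w => x * w)).
    by move=> y z yz; exact: natleM.
  move=> X [Xx _] w; rewrite -[x in X in _ <-> X]sinvK.
  apply: Uset_gmull (composableVl X) _.
  by rewrite Uset_ginv sinvK.
exists (fun Y : dirclass T => dirclass1 x * Y).
  by move=> X /set_mem[/gsourceK].
apply: (@continuous_Uset _ _ (fun w => x^-1 * w)).
  by move=> y z yz; exact: natleM.
move=> _ [X [Xx _] <-] w; rewrite /Uset /= dirclass1M dirclass1V.
apply: natle_divl => //; rewrite (gsourceK Xx).
by have := congr1 sinv (natleV Xx); rewrite !sinvM !sinvK.
Qed.

(** * The embedding of [T] into the inverse semigroup of G-sets *)

Lemma is_gset_Uset x : is_gset (@Uset T x).
Proof.
by have := is_gset_Ubasic x [::]; rewrite /Ubasic set_nil bigcap_set0 setIT.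
Qed.

Lemma UsetM x y : Uset (x * y) = gmulset (@Uset T x) (Uset y).
Proof.
apply/seteqP; split=> [|_ [X [Y [Xx Yy _ ->]]]]; last first.
  by rewrite /Uset /= dirclass1M; exact: natleM.
move=> Z; rewrite /Uset /= dirclass1M.
move=> /(@natle_factor (dirclass T))[Xx Yy XY ZE].
exists ((Z : dirclass T) * (Z : dirclass T)^-1 * dirclass1 x).
by exists ((dirclass1 x)^-1 * Z); split=> //; exact/esym.
Qed.

Lemma UsetV x : Uset (x^-1) = ginvset (@Uset T x).
Proof.
apply/seteqP; split=> [X /Uset_ginv Xx|_ [X Xx <-]].
  by exists (ginv X) => //; exact: ginvK.
by apply/Uset_ginv; rewrite sinvK.
Qed.

Lemma Uset_inj : injective (@Uset T).
Proof.
have key x y : Uset x = Uset y -> x \prec y.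
  (* The principal class of [x] belongs to [Uset x], hence to [Uset y]. *)
  by move=> xy; apply/natle_dirclass1; rewrite -[_ \prec _]/(Uset y _) -xy.
by move=> x y xy; apply: natle_anti; exact: key.
Qed.

End GuTopology.

Theorem theorem1 (T : invSemigroupType) :
  [/\ is_topological_groupoid (Gu T),
      basis (Ufamily T),
      (forall V : set (Gu T), open V <->
         exists2 F : set (set (Gu T)), F `<=` Ufamily T &
           V = \bigcup_(B in F) B),
      (forall (x : T) (s : seq T), (forall y, y \in s -> y \prec x) ->
         [/\ cover_compact (Ubasic x s), is_gset (Ubasic x s),
             homeo_onto_image (@grange (Gu T)) (Ubasic x s) &
             homeo_onto_image (@gsource (Gu T)) (Ubasic x s)])
    & exists U : T -> gset (Gu T),
        [/\ (forall x, U x = Uset x :> set (Gu T)),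
            injective U,
            {morph U : x y / x * y} &
            {morph U : x / x^-1}]].
Proof.
split.
- exact: Gu_is_topological_groupoid.
- exact: basis_Ufamily.
- exact: Gu_openE.
- move=> x s sx; split.
  + exact/compact_cover_compact/compact_Ubasic.
  + exact: is_gset_Ubasic.
  + exact: homeo_grange.
  + exact: homeo_gsource.
- exists (fun x => Gset (is_gset_Uset x)); split=> //.
  + by move=> x y /(congr1 (@gset_set _)); exact: Uset_inj.
  + by move=> x y; apply: gset_eq; exact: UsetM.
  + by move=> x; apply: gset_eq; exact: UsetV.
Qed.
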